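(* Let $n,m$ be integers with $m\geq n-1\geq 1$, and for each positive integer $\ell$ let $G$ be the group given by the presentation $$G=\Big\langle a_1,\dots,a_n,c_1,\dots,c_m \ \Big|\ [a_i,a_j]=\prod_{t=1}^m c_t^{\lambda_t^{ij}}\ (1\le i<j\le n),\ [a_i,c_j]=[c_k,c_r]=1 \text{ for all } i,j,k,r\Big\rangle,$$ where the integers $\lambda_t^{ij}$ are chosen independently and uniformly at random among the integers with $|\lambda_t^{ij}|\le\ell$. Write $C=\{c_1,\dots,c_m\}$. Then, asymptotically almost surely as $\ell\to\infty$: (1) If $m\le n(n-1)/2$, then $G'$ has finite index in $\langle C\rangle$; if additionally $m\ge n-1$, then $G$ is regular. (2) If $m>n(n-1)/2$, then $\{[a_i,a_j]\mid i<j\}$ is a basis of the free abelian group $G'$, $G'$ has infinite index in $\langle C\rangle$, and $G$ is not regular; moreover, the last two properties (infinite index of $G'$ in $\langle C\rangle$ and non-regularity) hold for every choice of the exponents, not only a.a.s.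
   Context: Commutators: $[g,h]=g^{-1}h^{-1}gh$; $G'$ is the subgroup generated by commutators. A property holds asymptotically almost surely (a.a.s.) if the probability that the randomly chosen group has it tends to $1$ as $\ell\to\infty$. A group $G$ is regular if $Z(G)\le \mathit{Is}(G')=\{g\in G\mid g^t\in G' \text{ for some } t\in\mathbb{Z}\setminus\{0\}\}$. *)

(* Defs.v *)
From mathcomp Require Import all_boot all_algebra.
Set Implicit Arguments. Unset Strict Implicit. Unset Printing Implicit Defensive.

Record group := Group {
  gcar :> Type;
  gmul : gcar -> gcar -> gcar;
  gone : gcar;
  ginv : gcar -> gcar;
  gmulA : forall x y z, gmul x (gmul y z) = gmul (gmul x y) z;
  gmul1 : forall x, gmul gone x = x;
  gmulV : forall x, gmul (ginv x) x = gone }.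

Section GroupDefs.
Variable G : group.
Local Notation "x * y" := (gmul x y).

Definition gcomm (g h : G) : G := ginv g * (ginv h * (g * h)).

Definition gexpn (g : G) (k : nat) : G := iter k (gmul g) (gone G).
Definition gexpz (g : G) (z : int) : G :=
  match z with Posz k => gexpn g k | Negz k => gexpn (ginv g) k.+1 end.

Inductive gen (S : G -> Prop) : G -> Prop :=
| gen_mem x : S x -> gen S x
| gen_one : gen S (gone G)
| gen_mul x y : gen S x -> gen S y -> gen S (x * y)
| gen_inv x : gen S x -> gen S (ginv x).

Definition derived : G -> Prop := gen (fun g => exists x y, g = gcomm x y).

Definition center (g : G) : Prop := forall h, g * h = h * g.

Definition isolator_derived (g : G) : Prop :=
  exists t : int, t <> 0%R /\ derived (gexpz g t).

Definition regular : Prop := forall g, center g -> isolator_derived g.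

(** H (intersected with K) has finite index in K: finitely many cosets
    r (H :&: K) with r in K cover K. *)
Definition finite_index (H K : G -> Prop) : Prop :=
  exists (k : nat) (r : 'I_k -> G), (forall i, K (r i)) /\
    forall x, K x -> exists i y, H y /\ K y /\ x = r i * y.

Definition prodz (I : finType) (f : I -> G) (e : I -> int) : G :=
  foldr (fun i acc => gexpz (f i) (e i) * acc) (gone G) (enum I).

Definition free_abelian_basis (H : G -> Prop) (I : finType) (f : I -> G) : Prop :=
  [/\ forall i, H (f i),
      forall x y, H x -> H y -> x * y = y * x,
      forall x, H x -> exists e : I -> int, x = prodz f e
    & forall e : I -> int, prodz f e = gone G -> forall i, e i = 0%R].

End GroupDefs.

Definition is_hom (G H : group) (phi : G -> H) : Prop :=
  forall x y, phi (gmul x y) = gmul (phi x) (phi y).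

Definition Pairs (n : nat) := {p : 'I_n * 'I_n | p.1 < p.2}.

Definition satisfies_rels (n m : nat) (lam : Pairs n -> 'I_m -> int)
  (G : group) (a : 'I_n -> G) (c : 'I_m -> G) : Prop :=
  [/\ forall p : Pairs n,
        gcomm (a (sval p).1) (a (sval p).2)
        = foldr (fun t acc => gmul (gexpz (c t) (lam p t)) acc) (gone G) (enum 'I_m),
      forall i j, gcomm (a i) (c j) = gone G
    & forall k r, gcomm (c k) (c r) = gone G].

(** (G, a, c) is the group given by the presentation: the relations hold and
    it has the universal property of the presented group. *)
Definition presents (n m : nat) (lam : Pairs n -> 'I_m -> int)
  (G : group) (a : 'I_n -> G) (c : 'I_m -> G) : Prop :=
  satisfies_rels lam a c /\
  forall (H : group) (a' : 'I_n -> H) (c' : 'I_m -> H),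
    satisfies_rels lam a' c' ->
    (exists phi : G -> H, [/\ is_hom phi, forall i, phi (a i) = a' i
                                        & forall j, phi (c j) = c' j]) /\
    (forall phi psi : G -> H, is_hom phi -> is_hom psi ->
       (forall i, phi (a i) = psi (a i)) -> (forall j, phi (c j) = psi (c j)) ->
       forall x, phi x = psi x).

(** decoding a sample: entry k in 'I_(2l+1) stands for k - l in [-l, l] *)
Definition decode (n m l : nat) (L : {ffun Pairs n * 'I_m -> 'I_(2 * l + 1)})
  : Pairs n -> 'I_m -> int :=
  fun p t => ((L (p, t) : nat)%:Z - l%:Z)%R.

(** P holds asymptotically almost surely as l -> oo, the exponents being
    independent and uniform in [-l, l]: for every k > 0, for l large enough
    the proportion of samples failing P is at most 1/k. *)
Definition aas (n m : nat) (P : (Pairs n -> 'I_m -> int) -> Prop) : Prop :=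
  forall k : nat, 0 < k -> exists l0 : nat, forall l : nat, l0 <= l ->
    exists S : {set {ffun Pairs n * 'I_m -> 'I_(2 * l + 1)}},
      (forall L, L \in S -> P (decode L)) /\
      k * (#|{ffun Pairs n * 'I_m -> 'I_(2 * l + 1)}| - #|S|)
        <= #|{ffun Pairs n * 'I_m -> 'I_(2 * l + 1)}|.

Definition genC (m : nat) (G : group) (c : 'I_m -> G) : G -> Prop :=
  gen (fun g => exists j, g = c j).

(* Main.v *)
(* G is the central extension of Z^n by Z^m = <C> with cocycle
   [sum_(i<j) x_i y_j lam^(ij)], so G' is the lattice spanned in Z^m by the
   N = n(n-1)/2 vectors lam^(ij), and (x, z) is central iff the commutator form
   vanishes at x.  A given minor of a matrix with independent uniform entries
   vanishes with probability O(1/l).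
   If m <= N, a nonzero m x m minor d gives d Z^m <= G', and a nonzero
   (n-1) x (n-1) minor of the rows lam^(1j), which exists only if m >= n-1,
   forces x = 0 for every central (x, z).
   If m > N, a nonzero N x N minor makes the lam^(ij) independent; and for every
   choice of exponents some nonzero integer vector v is orthogonal to all of
   them, so no nontrivial power of the central element (0, v) lies in G'. *)
Require Import Defs.
From mathcomp Require Import all_boot all_order all_algebra zify.
From Stdlib Require Import ProofIrrelevance.

Set Implicit Arguments.
Unset Strict Implicit.
Unset Printing Implicit Defensive.

Import Order.TTheory GRing.Theory Num.Theory.

(** * Powers, generated subgroups, and normal forms modulo a central subgroup *)

Section GroupTheory.
Variable G : group.
Implicit Types (x y z : G) (S : G -> Prop).
Local Notation "x * y" := (gmul x y).
Local Notation "1" := (gone G).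

Lemma gmulKV x y : ginv x * (x * y) = y.
Proof. by rewrite gmulA gmulV gmul1. Qed.

Lemma gmul_inj x y z : x * y = x * z -> y = z.
Proof. by move=> e; rewrite -(gmulKV x y) e gmulKV. Qed.

Lemma gmulr1 x : x * 1 = x.
Proof.
by apply: (@gmul_inj (ginv x)); rewrite gmulA gmulV gmul1.
Qed.

Lemma gmulrV x : x * ginv x = 1.
Proof. by apply: (@gmul_inj (ginv x)); rewrite gmulKV gmulr1. Qed.

Lemma gmulK x y : x * (ginv x * y) = y.
Proof. by rewrite gmulA gmulrV gmul1. Qed.

Lemma ginv_uniq x y : x * y = 1 -> ginv x = y.
Proof. by move=> e; apply: (@gmul_inj x); rewrite e gmulrV. Qed.

Lemma ginv1 : ginv 1 = 1.
Proof. by apply: ginv_uniq; rewrite gmul1. Qed.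

Lemma gcommP x y z : y * x * z = x * y -> gcomm x y = z.
Proof. by rewrite /gcomm => <-; rewrite -gmulA !gmulKV. Qed.

Lemma gcommE x y : x * y = y * x * gcomm x y.
Proof. by rewrite /gcomm -gmulA !gmulK. Qed.

Lemma gexpz_succ x (k : int) : gexpz x (1 + k)%R = x * gexpz x k.
Proof.
case: k => [k|[|k]]; first by [].
- by rewrite /= gmulK.
- by rewrite (_ : (1 + Negz k.+1)%R = Negz k) 1?[RHS]gmulK // !NegzE; lia.
Qed.

Lemma gexpz_pred x (k : int) : gexpz x (- 1 + k)%R = ginv x * gexpz x k.
Proof. by apply: (@gmul_inj x); rewrite -gexpz_succ gmulK addrA subrr add0r. Qed.

Lemma gexpzD x (j k : int) : gexpz x (j + k)%R = gexpz x j * gexpz x k.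
Proof.
elim/int_ind: j => [|j IH|j IH]; first by rewrite add0r /= gmul1.
- by rewrite intS -addrA !gexpz_succ IH gmulA.
- by rewrite intS opprD -addrA !gexpz_pred IH gmulA.
Qed.

Lemma gen_gexpz S x (k : int) : gen S x -> gen S (gexpz x k).
Proof.
move=> Sx; case: k => k; rewrite /gexpz.
  by elim: k => [|k IH]; [exact: gen_one | apply: (gen_mul Sx IH)].
by elim: {k}k.+1 => [|k IH]; [exact: gen_one | apply: (gen_mul (gen_inv Sx) IH)].
Qed.

Lemma gen_prodz S (I : finType) (f : I -> G) (e : I -> int) :
  (forall i, gen S (f i)) -> gen S (prodz f e).
Proof.
move=> Sf; rewrite /prodz; elim: (enum I) => [|i s IH] /=; first exact: gen_one.
by apply: gen_mul => //; apply: gen_gexpz.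
Qed.

Lemma gen_sub S S' x : (forall y, S y -> gen S' y) -> gen S x -> gen S' x.
Proof.
by move=> SS'; elim=> // [|y z _ ? _ ?|y _ ?];
  [exact: gen_one | exact: gen_mul | exact: gen_inv].
Qed.

Lemma gen_centralizes S x y : (forall z, S z -> x * z = z * x) ->
  gen S y -> x * y = y * x.
Proof.
move=> Sx; elim=> // [|u v _ IHu _ IHv|u _ IHu].
- by rewrite gmul1 gmulr1.
- by rewrite gmulA IHu -!gmulA IHv.
- by apply: (@gmul_inj u); rewrite gmulK gmulA -IHu -gmulA gmulrV gmulr1.
Qed.

(* [N] generates <C> when [f] below is the family [a_i], and is empty when [f] is
   the family [c_j]. *)
Section ModCentral.
Variable N : G -> Prop.
Hypothesis N_center : forall x, gen N x -> center x.
Definition commute_mod x y := exists2 w, gen N w & x * y = y * x * w.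

(** Since [gen N] is central, the [y] with [[x, y]] in [gen N] form a subgroup: error factors can be
    slid to the right end and multiplied there. *)
Lemma commute_mod_gen S x y : (forall z, S z -> commute_mod x z) ->
  gen S y -> commute_mod x y.
Proof.
move=> Sx; elim=> // [|u v _ [w Nw ew] _ [w' Nw' ew']|u _ [w Nw ew]].
- by exists 1; [exact: gen_one | rewrite gmul1 !gmulr1].
- exists (w * w'); first exact: gen_mul.
  rewrite gmulA ew -!gmulA (N_center Nw v) (gmulA x) ew' -!gmulA.
  by rewrite (N_center Nw).
- exists (ginv w); first exact: gen_inv.
  have Nw' := gen_inv Nw.
  have eux : u * x = x * u * ginv w by rewrite ew -gmulA gmulrV gmulr1.
  apply: (@gmul_inj u); rewrite -[in RHS]gmulA gmulK gmulA eux -!gmulA.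
  by rewrite (N_center Nw') gmulK.
Qed.

Lemma commute_mod_sym x y : commute_mod x y -> commute_mod y x.
Proof.
case=> w Nw e; exists (ginv w); first exact: gen_inv.
by rewrite e -gmulA gmulrV gmulr1.
Qed.

Section Family.
Variables (I : finType) (f : I -> G).
Hypothesis f_comm : forall i j, commute_mod (f i) (f j).

Lemma commute_mod_family x y : gen (fun g => exists i, g = f i) x ->
  gen (fun g => exists i, g = f i) y -> commute_mod x y.
Proof.
move=> Sx; apply: commute_mod_gen => _ [j ->].
apply: commute_mod_sym; apply: commute_mod_gen Sx => _ [i ->].
exact: f_comm.
Qed.

(** Collection process: the power of [f i] in the second product is moved left across the tail of
    the first, and each crossing costs a central factor from [gen N], gathered at the end. *)
Lemma prodzD e e' : exists2 w, gen N w &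
  prodz f e * prodz f e' = prodz f (fun i => (e i + e' i)%R) * w.
Proof.
have Sf i : gen (fun g => exists i, g = f i) (f i) by apply: gen_mem; exists i.
rewrite /prodz; elim: (enum I) => [|i s [w Nw ew]] /=.
  by exists 1; [exact: gen_one | rewrite gmul1].
set A := foldr _ _ _ in ew *; set B := foldr _ _ _ in ew *.
set D := foldr _ _ _ in ew *.
have [||v Nv ev] := @commute_mod_family A (gexpz (f i) (e' i)).
- by rewrite /A; elim: (s) => [|j r IH] /=; [exact: gen_one |
    apply: gen_mul => //; apply: gen_gexpz].
- exact: gen_gexpz.
exists (w * v); first exact: gen_mul.
rewrite gexpzD -!gmulA; congr (_ * _).
by rewrite (gmulA A) ev -!gmulA (N_center Nv) (gmulA A) ew -gmulA.
Qed.

Lemma prodz0 : prodz f (fun=> 0%R) = 1.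
Proof. by rewrite /prodz; elim: (enum I) => //= i s ->; rewrite gmul1. Qed.

Lemma eq_prodz e e' : e =1 e' -> prodz f e = prodz f e'.
Proof. by move=> ee; rewrite /prodz; elim: (enum I) => //= i s ->; rewrite ee. Qed.

Lemma eq_prodz_fun f' e : f =1 f' -> prodz f e = prodz f' e.
Proof. by move=> ff; rewrite /prodz; elim: (enum I) => //= i s ->; rewrite ff. Qed.

Lemma prodz_delta i : prodz f (fun j => Posz (i == j)) = f i.
Proof.
rewrite /prodz.
have: i \in enum I by rewrite mem_enum.
have: uniq (enum I) by rewrite enum_uniq.
elim: (enum I) => //= j s IH /andP[js us]; rewrite inE.
have [ij _|_] := eqVneq i j; last by rewrite /= gmul1; apply: IH.
rewrite -{}ij in js *; rewrite /= gmulr1 (_ : foldr _ _ _ = 1) ?gmulr1 //.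
elim: s js {IH us} => [|k s IH] //=; rewrite inE negb_or => /andP[ik ks].
by rewrite IH // (negPf ik) gmul1.
Qed.

(** The products of this shape form a subgroup, by [prodzD]; for inverses it is applied to the
    exponents [e] and [-e], whose sum gives the trivial product. *)
Lemma gen_normal_form x : gen (fun g => (exists i, g = f i) \/ N g) x ->
  exists e, exists2 w, gen N w & x = prodz f e * w.
Proof.
elim=> {x} [y [[i ->]|Ny]| |y z _ [e [w Nw ->]] _ [e' [w' Nw' ->]]|y _ [e [w Nw ->]]].
- exists (fun j => Posz (i == j)), 1; first exact: gen_one.
  by rewrite gmulr1 prodz_delta.
- by exists (fun=> 0%R), y; [exact: gen_mem | rewrite prodz0 gmul1].
- by exists (fun=> 0%R), 1; [exact: gen_one | rewrite prodz0 gmul1].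
- have [v Nv ev] := prodzD e e'.
  exists (fun i => (e i + e' i)%R), (v * w * w'); first by do 2?apply: gen_mul.
  by rewrite !gmulA -ev -!gmulA; congr (_ * _); rewrite gmulA (N_center Nw) -gmulA.
- have [v Nv ev] := prodzD e (fun i => (- e i)%R).
  exists (fun i => (- e i)%R), (ginv w * ginv v).
    by apply: gen_mul; apply: gen_inv.
  apply: ginv_uniq; rewrite (gmulA (prodz f _)) -(N_center (gen_inv Nw)) !gmulA.
  have -> : prodz f e * w * ginv w = prodz f e by rewrite -gmulA gmulrV gmulr1.
  rewrite ev (@eq_prodz _ (fun=> 0%R)) ?prodz0 ?gmul1 ?gmulrV // => i.
  exact: subrr.
Qed.

End Family.
End ModCentral.
End GroupTheory.

(** * Homomorphisms, and generated subgroups as groups *)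

Section Hom.
Variables (G H : group) (phi : G -> H).
Hypothesis phiM : is_hom phi.

Lemma hom1 : phi (gone G) = gone H.
Proof. by apply: (@gmul_inj _ (phi (gone G))); rewrite -phiM gmul1 gmulr1. Qed.

Lemma homV x : phi (ginv x) = ginv (phi x).
Proof. by apply/esym/ginv_uniq; rewrite -phiM gmulrV hom1. Qed.

Lemma hom_comm x y : phi (gcomm x y) = gcomm (phi x) (phi y).
Proof. by rewrite /gcomm !phiM !homV. Qed.

Lemma hom_expz x k : phi (gexpz x k) = gexpz (phi x) k.
Proof.
have hexpn y j : phi (gexpn y j) = gexpn (phi y) j.
  by elim: j => [|j IH] /=; [exact: hom1 | rewrite phiM IH].
by case: k => k; rewrite /gexpz hexpn ?homV.
Qed.

Lemma hom_prodz (I : finType) (f : I -> G) e :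
  phi (prodz f e) = prodz (fun i => phi (f i)) e.
Proof.
rewrite /prodz; elim: (enum I) => [|i s IH] /=; first exact: hom1.
by rewrite phiM hom_expz IH.
Qed.

Lemma hom_gen (S : G -> Prop) (S' : H -> Prop) x :
  (forall y, S y -> S' (phi y)) -> gen S x -> gen S' (phi x).
Proof.
move=> SS'; elim=> [y /SS'||y z _ IHy _ IHz|y _ IHy].
- exact: gen_mem.
- by rewrite hom1; apply: gen_one.
- by rewrite phiM; apply: gen_mul.
- by rewrite homV; apply: gen_inv.
Qed.

Lemma hom_derived x : derived x -> derived (phi x).
Proof.
by apply: hom_gen => _ [y [z ->]]; exists (phi y), (phi z); exact: hom_comm.
Qed.

End Hom.

Section Subgroup.
Variables (G : group) (S : G -> Prop).
Let T := {x : G | gen S x}.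
Let val_inj (u v : T) : sval u = sval v -> u = v.
Proof.
case: u v => x Sx [y Sy] /= e; case: y / e Sy => Sy.
(* An element carries a derivation of its membership, so equality of elements must ignore which
   derivation it is. *)
by rewrite (proof_irrelevance _ Sx Sy).
Qed.
Let mul (u v : T) : T := exist _ _ (gen_mul (svalP u) (svalP v)).
Let one : T := exist _ _ (gen_one S).
Let inv (u : T) : T := exist _ _ (gen_inv (svalP u)).
Let mulA u v w : mul u (mul v w) = mul (mul u v) w.
Proof. exact/val_inj/gmulA. Qed.
Let mul1 u : mul one u = u.
Proof. exact/val_inj/gmul1. Qed.
Let mulV u : mul (inv u) u = one.
Proof. exact/val_inj/gmulV. Qed.
Definition subgroup := Defs.Group mulA mul1 mulV.
Definition subgroup_val (u : subgroup) : G := sval u.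
Definition subgroup_mem x (Sx : gen S x) : subgroup := exist _ x Sx.

Lemma subgroup_valM : is_hom subgroup_val. Proof. by []. Qed.
Lemma subgroup_val_inj : injective subgroup_val. Proof. exact: val_inj. Qed.
Lemma subgroup_valP u : gen S (subgroup_val u). Proof. exact: svalP. Qed.
End Subgroup.

Lemma relsE n m (lam : Pairs n -> 'I_m -> int) (G : group) a c :
  @satisfies_rels n m lam G a c <->
  [/\ forall p : Pairs n, gcomm (a (sval p).1) (a (sval p).2) = prodz c (lam p),
      forall i j, gcomm (a i) (c j) = gone G
    & forall k r, gcomm (c k) (c r) = gone G].
Proof. by []. Qed.

(* The universal property provides a retraction of [G] onto the subgroup generated
   by the [a_i] and [c_j], whose composite with the inclusion must be [id]. *)
Lemma presents_gen n m (lam : Pairs n -> 'I_m -> int) (G : group) a c :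
  @presents n m lam G a c ->
  forall x, gen (fun g => (exists i, g = a i) \/ (exists j, g = c j)) x.
Proof.
set S := fun g => _; case=> /relsE[rac rac0 rcc0] univ x.
have Sa i : gen S (a i) by apply: gen_mem; left; exists i.
have Sc j : gen S (c j) by apply: gen_mem; right; exists j.
have rels : @satisfies_rels n m lam (subgroup S)
    (fun i => subgroup_mem (Sa i)) (fun j => subgroup_mem (Sc j)).
  apply/relsE; have valM := @subgroup_valM G S.
  split=> [p|i j|k r]; apply: subgroup_val_inj.
  - by rewrite (hom_comm valM) (hom_prodz valM); exact: rac.
  - by rewrite (hom_comm valM) (hom1 valM); exact: rac0.
  - by rewrite (hom_comm valM) (hom1 valM); exact: rcc0.
have [[phi [phiM phia phic]] _] := univ _ _ _ rels.
have [_ uniq] := univ _ _ _ (And3 rac rac0 rcc0 : satisfies_rels lam a c).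
suff <- : subgroup_val (phi x) = x by exact: subgroup_valP.
apply: (uniq (fun g => subgroup_val (phi g)) id) => //.
- by move=> u v; rewrite phiM.
- by move=> i; rewrite phia.
- by move=> j; rewrite phic.
Qed.

(** * The explicit model: a central extension of Z^n by Z^m *)

Definition zgroup (V : zmodType) : group :=
  Defs.Group (@addrA V) (@add0r V) (@addNr V).

Lemma zgroup_expz (V : zmodType) (x : V) (k : int) :
  @gexpz (zgroup V) x k = (x *~ k)%R.
Proof.
elim/int_ind: k => [//|k IH|k IH]; rewrite intS ?opprD.
  by rewrite gexpz_succ IH mulrzDr.
by rewrite gexpz_pred IH mulrzDr mulrN1z.
Qed.

Lemma zgroup_prodz (V : zmodType) (I : finType) (f : I -> V) e :
  @prodz (zgroup V) I f e = (\sum_i f i *~ e i)%R.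
Proof.
rewrite -big_enum /prodz; elim: (enum I) => [|i s IH]; first by rewrite big_nil.
by rewrite big_cons /= zgroup_expz IH.
Qed.

Lemma Pairs_lt n (p : Pairs n) : (sval p).1 < (sval p).2.
Proof. by case: p. Qed.

Section Model.
Local Open Scope ring_scope.
Variables (n m : nat) (lam : Pairs n -> 'I_m -> int).

Definition rel_row (p : Pairs n) : 'rV[int]_m := \row_t lam p t.

Definition cocycle (x y : 'rV[int]_n) : 'rV[int]_m :=
  \sum_p (x 0 (sval p).1 * y 0 (sval p).2) *: rel_row p.

Lemma cocycleDl x x' y : cocycle (x + x') y = cocycle x y + cocycle x' y.
Proof.
by rewrite -big_split; apply: eq_bigr => p _; rewrite !mxE mulrDl scalerDl.
Qed.

Lemma cocycleDr x y y' : cocycle x (y + y') = cocycle x y + cocycle x y'.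
Proof.
by rewrite -big_split; apply: eq_bigr => p _; rewrite !mxE mulrDr scalerDl.
Qed.

Lemma cocycle0l y : cocycle 0 y = 0.
Proof. by apply: (addIr (cocycle 0 y)); rewrite -cocycleDl !add0r. Qed.

Lemma cocycle0r x : cocycle x 0 = 0.
Proof. by apply: (addIr (cocycle x 0)); rewrite -cocycleDr !add0r. Qed.

Lemma cocycleNl x y : cocycle (- x) y = - cocycle x y.
Proof. by apply: (addIr (cocycle x y)); rewrite -cocycleDl !addNr cocycle0l. Qed.

Let T : Type := ('rV[int]_n * 'rV[int]_m)%type.
Let mul (u v : T) : T := (u.1 + v.1, u.2 + v.2 + cocycle u.1 v.1).
Let one : T := (0, 0).
Let inv (u : T) : T := (- u.1, - u.2 + cocycle u.1 u.1).
(** Associativity is the 2-cocycle identity, which holds because [cocycle] is biadditive. *)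
Let mulA u v w : mul u (mul v w) = mul (mul u v) w.
Proof.
congr pair; rewrite /= ?addrA // cocycleDl cocycleDr -!addrA.
congr (_ + (_ + _)); rewrite [RHS]addrCA; congr (_ + _).
by rewrite addrC addrA.
Qed.
Let mul1 u : mul one u = u.
Proof. by case: u => x z; congr pair; rewrite /= ?cocycle0l ?addr0 add0r. Qed.
Let mulV u : mul (inv u) u = one.
Proof.
by congr pair; rewrite /= ?addNr // cocycleNl addrAC addrK addNr.
Qed.
Definition model := Defs.Group mulA mul1 mulV.

Definition model_base (u : model) : zgroup 'rV[int]_n := u.1.
Definition model_center (z : zgroup 'rV[int]_m) : model := (0, z).
Lemma model_baseM : is_hom model_base. Proof. by []. Qed.
Lemma model_centerM : is_hom model_center.
Proof. by move=> y z; congr pair; rewrite /= ?cocycle0l addr0. Qed.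

Lemma model_comm (u v : model) :
  gcomm u v = model_center (cocycle u.1 v.1 - cocycle v.1 u.1).
Proof.
apply: gcommP; congr pair; first by rewrite /= addr0 addrC.
rewrite /= cocycle0r addr0 (addrC v.2) -[LHS]addrA; congr (_ + _).
by rewrite addrC subrK.
Qed.

Definition model_a i : model := (delta_mx 0 i, 0).
Definition model_c j : model := model_center (delta_mx 0 j).

Lemma sum_delta k (e : 'I_k -> int) :
  \sum_i (delta_mx 0 i : 'rV[int]_k) *~ e i = \row_i e i.
Proof.
rewrite [RHS]row_sum_delta; apply: eq_bigr => i _.
by rewrite mxE -[in RHS](intz (e i)) scaler_int.
Qed.

Lemma model_prodz_c e : prodz model_c e = model_center (\row_j e j).
Proof.
by rewrite -(hom_prodz model_centerM) zgroup_prodz sum_delta.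
Qed.

(** Only the base component is recorded. The central one also collects cocycle terms, for which
    [presents_iso] corrects without computing them. *)
Lemma model_prodz_a e : model_base (prodz model_a e) = \row_i e i.
Proof.
by rewrite (hom_prodz model_baseM) zgroup_prodz sum_delta.
Qed.

Lemma cocycle_delta_lt (p : Pairs n) :
  cocycle (delta_mx 0 (sval p).1) (delta_mx 0 (sval p).2) = rel_row p.
Proof.
rewrite /cocycle (bigD1 p) //= !mxE !eqxx scale1r big1 ?addr0 // => q qp.
rewrite !mxE /= -natrM mulnb; case: andP => [[/eqP e1 /eqP e2]|]; last by rewrite scale0r.
by case/eqP: qp; apply: val_inj; rewrite [LHS]surjective_pairing e1 e2 -surjective_pairing.
Qed.

Lemma cocycle_delta_gt (p : Pairs n) :
  cocycle (delta_mx 0 (sval p).2) (delta_mx 0 (sval p).1) = 0.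
Proof.
rewrite /cocycle big1 // => q _.
rewrite !mxE /= -natrM mulnb; case: andP => [[/eqP e1 /eqP e2]|]; last by rewrite scale0r.
by have := Pairs_lt q; rewrite e1 e2 ltnNge ltnW ?Pairs_lt.
Qed.

Lemma model_rels : satisfies_rels lam model_a model_c.
Proof.
apply/relsE; split=> [p|i j|k r]; rewrite model_comm /=.
- by rewrite model_prodz_c cocycle_delta_lt cocycle_delta_gt subr0.
- by rewrite cocycle0r cocycle0l subrr.
- by rewrite cocycle0r subrr.
Qed.
End Model.

(** * Isomorphism of the presented group with the model *)

Lemma gcomm1 (G : group) (x y : G) : gcomm x y = gone G -> gmul x y = gmul y x.
Proof. by move=> e; rewrite gcommE e gmulr1. Qed.

Section Presented.
Local Open Scope ring_scope.
Variables (n m : nat) (lam : Pairs n -> 'I_m -> int).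
Variables (G : group) (a : 'I_n -> G) (c : 'I_m -> G).

Definition model_iso (phi : G -> model lam) (psi : model lam -> G) :=
  [/\ is_hom phi /\ is_hom psi, cancel phi psi /\ cancel psi phi,
      forall i, phi (a i) = model_a lam i & forall j, phi (c j) = model_c lam j].

Hypothesis presG : presents lam a c.

Lemma presents_c_center j : center (c j).
Proof.
case: presG => /relsE[_ rac0 rcc0] _ h.
apply: gen_centralizes (presents_gen presG h) => _ [[i ->]|[k ->]].
  exact/esym/gcomm1.
exact: gcomm1.
Qed.

(** [gen_normal_form] is used twice: on the [a i] modulo the central subgroup generated by the
    [c j], then on the [c j] modulo the trivial subgroup. *)
Lemma presents_normal_form x :
  exists e z, x = gmul (prodz a e) (prodz c z).
Proof.
pose N g := exists j, g = c j.
have Nc y : gen N y -> center y.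
  by move=> Ny h; apply/esym; apply: gen_centralizes Ny => _ [j ->];
     rewrite presents_c_center.
have [/relsE[rac _ _] _] := presG.
have comm_lt (i j : 'I_n) : (i < j)%N -> commute_mod N (a i) (a j).
  move=> ij; pose p : Pairs n := exist _ (i, j) ij.
  exists (gcomm (a i) (a j)); last exact: gcommE.
  by rewrite (rac p); apply: gen_prodz => k; apply: gen_mem; exists k.
have comm i j : commute_mod N (a i) (a j).
  case: (ltngtP i j) => [||/val_inj->]; first exact: comm_lt.
    by move=> ji; apply/commute_mod_sym/comm_lt.
  by exists (gone G); [exact: gen_one | rewrite gmulr1].
have [e [w Nw ->]] := @gen_normal_form G N Nc _ a comm x (presents_gen presG x).
have triv (y : G) : gen (fun=> False) y -> y = gone G.
  elim=> // [u v _ -> _ ->|u _ ->]; first by rewrite gmul1.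
  exact: ginv1.
have triv_center (y : G) : gen (fun=> False) y -> center y.
  by move=> ty h; rewrite (triv _ ty) gmul1 gmulr1.
have c_comm i j : commute_mod (fun=> False) (c i) (c j).
  exists (gone G); first exact: gen_one.
  by rewrite gmulr1 presents_c_center.
have [|z [v tv ->]] := @gen_normal_form G _ triv_center _ c c_comm w.
  by apply: gen_sub Nw => y Ny; apply: gen_mem; left.
by exists e, z; rewrite (triv _ tv) gmulr1.
Qed.

(** The universal property gives [phi]. It is injective because the exponents of a normal form can
    be read off in the model, and an explicit right inverse makes it bijective. *)
Lemma presents_iso : exists phi psi, model_iso phi psi.
Proof.
have [_ univ] := presG.
have [[phi [phiM phia phic]] _] := univ _ _ _ (model_rels lam).
have phi_a e : (phi (prodz a e)).1 = \row_i e i.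
  by rewrite (hom_prodz phiM) (eq_prodz_fun _ phia); apply: model_prodz_a.
have phi_c z : phi (prodz c z) = model_center lam (\row_i z i).
  by rewrite (hom_prodz phiM) (eq_prodz_fun _ phic) model_prodz_c.
have ker1 x : phi x = gone _ -> x = gone G.
  have [e [z ->]] := presents_normal_form x.
  rewrite phiM => e1.
  have e0 i : e i = 0.
    have := congr1 (fun u : model lam => u.1 0 i) e1.
    by rewrite /= phi_a phi_c !mxE addr0.
  rewrite (eq_prodz a e0) prodz0 in e1 *; rewrite gmul1.
  rewrite (hom1 phiM) gmul1 phi_c in e1.
  have z0 i : z i = 0.
    by have := congr1 (fun u : model lam => u.2 0 i) e1; rewrite /= !mxE.
  by rewrite (eq_prodz c z0) prodz0.
have inj : injective phi.
  move=> x y exy; apply: (@gmul_inj _ (ginv x)); rewrite gmulV; apply/esym/ker1.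
  by rewrite phiM (homV phiM) exy gmulV.
(* The product of the [a i] has the right base component; the product of the [c j] makes up the
   difference in the central one. *)
pose psi (u : model lam) := gmul (prodz a (u.1 0))
  (prodz c ((u.2 - (phi (prodz a (u.1 0))).2) 0)).
have psiK : cancel psi phi.
  move=> [x z]; rewrite phiM phi_c; set P := phi _.
  have P1 : P.1 = x by rewrite phi_a; apply/rowP => i; rewrite mxE.
  congr pair; rewrite /= ?P1 ?addr0 // cocycle0r addr0.
  by apply/rowP => i; rewrite !mxE addrC subrK.
exists phi, psi; split=> //; split=> //; last by move=> x; apply: inj.
by move=> u v; apply: inj; rewrite phiM !psiK.
Qed.

End Presented.

(** * Derived subgroup, index and regularity in terms of the lattice of rows *)

Section Transport.
Local Open Scope ring_scope.
Variables (n m : nat) (lam : Pairs n -> 'I_m -> int).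

(** The values of [comb] form the lattice in Z^m that corresponds to G'. *)
Definition comb (e : Pairs n -> int) : 'rV[int]_m := \sum_p e p *: rel_row lam p.

Lemma combB e e' : comb (fun p => e p - e' p) = comb e - comb e'.
Proof.
by rewrite -sumrB; apply: eq_bigr => p _; rewrite scalerBl.
Qed.

Lemma comb0 : comb (fun=> 0) = 0.
Proof. by rewrite /comb big1 // => p _; rewrite scale0r. Qed.

Lemma combN e : comb (fun p => - e p) = - comb e.
Proof. by rewrite -sumrN; apply: eq_bigr => p _; rewrite scaleNr. Qed.

Lemma combD e e' : comb (fun p => e p + e' p) = comb e + comb e'.
Proof. by rewrite -big_split; apply: eq_bigr => p _; rewrite scalerDl. Qed.

Lemma model_derived (u : model lam) :
  derived u -> exists e, u = model_center lam (comb e).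
Proof.
elim=> [_ [x [y ->]]||x y _ [e ->] _ [e' ->]|x _ [e ->]].
- exists (fun p => x.1 0 (sval p).1 * y.1 0 (sval p).2
                   - y.1 0 (sval p).1 * x.1 0 (sval p).2).
  by rewrite model_comm combB.
- by exists (fun=> 0); rewrite comb0.
- by exists (fun p => e p + e' p); rewrite combD model_centerM.
- by exists (fun p => - e p); rewrite combN (homV (@model_centerM _ _ lam)).
Qed.

Variables (G : group) (a : 'I_n -> G) (c : 'I_m -> G).
Variables (phi : G -> model lam) (psi : model lam -> G).
Hypothesis iso : model_iso a c phi psi.

Let phiM : is_hom phi. Proof. by case: iso => [[]]. Qed.
Let psiM : is_hom psi. Proof. by case: iso => [[]]. Qed.
Let phiK : cancel phi psi. Proof. by case: iso => _ []. Qed.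
Let psiK : cancel psi phi. Proof. by case: iso => _ []. Qed.

Lemma iso_prodz_comm e :
  phi (prodz (fun p : Pairs n => gcomm (a (sval p).1) (a (sval p).2)) e)
  = model_center lam (comb e).
Proof.
have [_ _ phia phic] := iso.
have phi_comm p : phi (gcomm (a (sval p).1) (a (sval p).2))
    = model_center lam (rel_row lam p).
  rewrite (hom_comm phiM) !phia model_comm /=.
  by rewrite cocycle_delta_lt cocycle_delta_gt subr0.
rewrite (hom_prodz phiM) (eq_prodz_fun _ phi_comm).
rewrite -(hom_prodz (@model_centerM _ _ lam)) zgroup_prodz; congr model_center.
by apply: eq_bigr => p _; rewrite -[in RHS](intz (e p)) scaler_int.
Qed.

Lemma iso_derived g :
  derived g <-> exists e, phi g = model_center lam (comb e).
Proof.
split=> [/(hom_derived phiM)/model_derived //|[e eg]].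
rewrite -(phiK g) eg -iso_prodz_comm phiK; apply: gen_prodz => p.
by apply: gen_mem; eexists; eexists.
Qed.

Lemma iso_genC g : genC c g <-> exists z, phi g = model_center lam z.
Proof.
have [_ _ _ phic] := iso; split=> [|[z eg]].
  elim=> [_ [j ->]||x y _ [z ez] _ [w ew]|x _ [z ez]].
  - by exists (delta_mx 0 j); rewrite phic.
  - by exists 0; rewrite (hom1 phiM).
  - by exists (z + w); rewrite phiM ez ew -model_centerM.
  - by exists (- z); rewrite (homV phiM) ez -(homV (@model_centerM _ _ lam)).
have -> : g = prodz c (z 0).
  rewrite -(phiK g) -[RHS]phiK; congr psi; rewrite eg (hom_prodz phiM).
  rewrite (eq_prodz_fun _ phic) model_prodz_c; congr model_center.
  by apply/rowP => j; rewrite mxE.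
by apply: gen_prodz => j; apply: gen_mem; exists j.
Qed.

(** The two products of [g] with [psi (y, 0)] have central components that differ by the commutator
    form at [(phi g).1] and [y]. *)
Lemma iso_center g : center g ->
  forall y, cocycle lam (phi g).1 y = cocycle lam y (phi g).1.
Proof.
move=> cg y; have := congr1 phi (cg (psi (y, 0))).
rewrite !phiM psiK => /(congr1 snd) /=.
by rewrite addr0 add0r => /addrI.
Qed.

Lemma iso_expz g z (t : int) : phi g = model_center lam z ->
  phi (gexpz g t) = model_center lam (t *: z).
Proof.
move=> eg; rewrite (hom_expz phiM) eg -(hom_expz (@model_centerM _ _ lam)).
by rewrite zgroup_expz -[in RHS](intz t) scaler_int.
Qed.

Section FullRank.
Variable d : int.
Hypotheses (d_neq0 : d != 0) (d_comb : forall z : 'rV[int]_m, exists e, d *: z = comb e).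

Lemma finite_index_full_rank : finite_index (derived (G:=G)) (genC c).
Proof.
(* The lattice contains d Z^m, so the vectors with entries in [0, |d|) represent all cosets;
   division with remainder finds the representative. *)
pose F := {ffun 'I_m -> 'I_`|d|%N}.
pose r (f : F) : 'rV[int]_m := \row_j (f j)%:Z.
exists #|F|, (fun i => psi (model_center lam (r (enum_val i)))).
split=> [i|x /iso_genC[z ex]].
  by apply/iso_genC; eexists; rewrite psiK.
have ltd j : (`|(z 0%R j %% d)%Z| < `|d|)%N.
  by rewrite -ltz_nat gez0_abs ?modz_ge0 ?ltz_mod.
pose f : F := [ffun j => Ordinal (ltd j)].
have [e ee] := d_comb (\row_j (z 0%R j %/ d)%Z).
exists (enum_rank f), (psi (model_center lam (comb e))); split; last split.
- by apply/iso_derived; exists e; rewrite psiK.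
- by apply/iso_genC; eexists; rewrite psiK.
rewrite enum_rankK -psiM -model_centerM -(phiK x) ex; congr (psi (_ _)).
rewrite -ee; apply/rowP => j; rewrite !mxE ffunE /= gez0_abs ?modz_ge0 //.
by rewrite addrC mulrC -divz_eq.
Qed.

(** By nondegeneracy a central element has the form (0, z), and its power with exponent [d] lies in
    the lattice. *)
Lemma regular_full_rank :
  (forall x, (forall y, cocycle lam x y = cocycle lam y x) -> x = 0) ->
  regular G.
Proof.
move=> nondeg g /iso_center/nondeg g1; exists d; split; first exact/eqP.
have eg : phi g = model_center lam (phi g).2 by case: (phi g) g1 => x z /= ->.
have [e ee] := d_comb (phi g).2.
by apply/iso_derived; exists e; rewrite (iso_expz _ eg) ee.
Qed.
End FullRank.

Section Torsion.
Variable v : 'rV[int]_m.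
Hypothesis v_free : forall (t : int) e, t *: v = comb e -> t = 0.

(** Pigeonhole: among the k+1 multiples 0, v, ..., kv two share one of the k cosets, so a nonzero
    multiple of [v] would lie in the lattice. *)
Lemma infinite_index_of_free : ~ finite_index (derived (G:=G)) (genC c).
Proof.
case=> k [r [_ cover]].
pose x (s : 'I_k.+1) := psi (model_center lam ((s : nat)%:Z *: v)).
have xC s : genC c (x s) by apply/iso_genC; eexists; rewrite psiK.
have /fin_all_exists[f fP] : forall s, exists i, exists y,
  derived y /\ x s = gmul (r i) y.
  by move=> s; have [i [y [? [_ ?]]]] := cover _ (xC s); exists i, y.
have /injectivePn[s [s' ss' fs]] : ~~ injectiveb f.
  by apply/injectiveP => /leq_card; rewrite !card_ord ltnn.
have [y [/iso_derived[e ey] exs]] := fP s.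
have [y' [/iso_derived[e' ey'] exs']] := fP s'.
have es (q : 'I_k.+1) i z w : x q = gmul (r i) z -> phi z = model_center lam w ->
    (q : nat)%:Z *: v = (phi (r i)).2 + w.
  move=> /(congr1 phi); rewrite psiK phiM => eq ez; move: eq; rewrite ez.
  by move=> /(congr1 snd) /=; rewrite cocycle0r addr0.
have : ((s : nat)%:Z - (s' : nat)%:Z) *: v = comb (fun p => e p - e' p).
  rewrite scalerBl combB (es _ _ _ _ exs ey) (es _ _ _ _ exs' ey') fs.
  by rewrite opprD addrACA subrr add0r.
move=> /v_free/eqP; rewrite subr_eq0 => /eqP[/val_inj] es'.
by rewrite es' eqxx in ss'.
Qed.

(** The witness is (0, v): it is central, and no power with nonzero exponent lies in G'. *)
Lemma not_regular_of_free : ~ regular G.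
Proof.
move=> reg; have [|t [t0 /iso_derived[e]]] := reg (psi (model_center lam v)).
  move=> h; rewrite -(phiK h) -!psiM; congr psi; congr pair.
    by rewrite /= addr0 add0r.
  by rewrite /= cocycle0l cocycle0r !addr0 addrC.
rewrite (@iso_expz _ v) ?psiK // => /(congr1 snd) /= /v_free.
exact: t0.
Qed.
End Torsion.

Lemma free_basis_of_independent : (forall e, comb e = 0 -> forall p, e p = 0) ->
  free_abelian_basis (derived (G:=G))
    (fun p : Pairs n => gcomm (a (sval p).1) (a (sval p).2)).
Proof.
move=> indep; split=> [p|x y|x|e].
- by apply: gen_mem; eexists; eexists.
- move=> /iso_derived[e ex] /iso_derived[e' ey].
  rewrite -(phiK x) -(phiK y) -!psiM ex ey -!model_centerM.
  by congr (psi (model_center _ _)); apply: addrC.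
- move=> /iso_derived[e ex]; exists e.
  by rewrite -(phiK x) ex -iso_prodz_comm phiK.
- move=> /(congr1 phi); rewrite iso_prodz_comm (hom1 phiM).
  by move=> /(congr1 snd) /=; apply: indep.
Qed.
End Transport.

(** * Consequences of a nonvanishing minor, and a vector orthogonal to all rows *)

Section Minors.
Local Open Scope ring_scope.
Variables (n m : nat).
Implicit Type lam : Pairs n -> 'I_m -> int.

(** [p] and [t] may repeat indices; injectivity is asked for only when singular samples are
    counted. *)
Definition minor lam k (p : 'I_k -> Pairs n) (t : 'I_k -> 'I_m) : 'M[int]_k :=
  \matrix_(i, j) lam (p i) (t j).

(** Restricting the relation to the columns [t] and multiplying by the adjugate gives det * w = 0
    over the integers. *)
Lemma minor_independent lam k (p : 'I_k -> Pairs n) (t : 'I_k -> 'I_m) w :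
  \det (minor lam p t) != 0 -> \sum_i w i *: rel_row lam (p i) = 0 ->
  forall i, w i = 0.
Proof.
move=> d0 e0 i; have wM : (\row_j w j) *m minor lam p t = 0.
  apply/rowP => j; have := congr1 (fun u : 'rV_m => u 0 (t j)) e0.
  rewrite summxE !mxE => s0; rewrite -[RHS]s0; apply: eq_bigr => q _.
  by rewrite !mxE.
have := congr1 (fun u => (u *m \adj (minor lam p t)) 0 i) wM.
rewrite -mulmxA mul_mx_adj mul_mx_scalar mul0mx !mxE => /eqP.
by rewrite mulf_eq0 (negPf d0) => /eqP.
Qed.

Lemma minor_span lam (p : 'I_m -> Pairs n) z :
  exists e, \det (minor lam p id) *: z = comb lam e.
Proof.
pose w := z *m \adj (minor lam p id).
(* Cramer's rule gives coefficients indexed by rows of the minor; those whose rows come from the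
   same pair are added up. *)
exists (fun q => \sum_(i | p i == q) w 0 i).
have -> : \det (minor lam p id) *: z = w *m minor lam p id.
  by rewrite -mulmxA mul_adj_mx mul_mx_scalar.
have -> : w *m minor lam p id = \sum_i w 0 i *: rel_row lam (p i).
  rewrite mulmx_sum_row; apply: eq_bigr => i _; congr (_ *: _).
  by apply/rowP => j; rewrite !mxE.
rewrite (partition_big p xpredT) //=; apply: eq_bigr => q _.
by rewrite scaler_suml; apply: eq_bigr => i /eqP->.
Qed.

(** With fewer rows than columns, some nonzero integer [v] is orthogonal to every row; pairing
    [t *: v = comb lam e] with [v] gives t |v|^2 = 0. *)
Lemma exists_free_vector lam : (#|{: Pairs n}| < m)%N ->
  exists v, forall (t : int) e, t *: v = comb lam e -> t = 0.
Proof.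
move=> ltm; set N := #|_| in ltm.
pose A : 'M[rat]_(m, N) := \matrix_(j, i) (lam (enum_val i) j)%:~R.
have /rowV0Pn[u /sub_kermxP uA u0] : kermx A != 0.
  rewrite -mxrank_eq0 mxrank_ker -lt0n subn_gt0.
  exact: leq_ltn_trans (rank_leq_col A) ltm.
(* Clearing denominators: [v] is the rational kernel vector [u] times the product [D] of all its
   denominators. *)
pose v : 'rV[int]_m := \row_j (numq (u 0 j) * \prod_(i | i != j) denq (u 0 i)).
pose D : rat := \prod_i (denq (u 0 i))%:~R.
have vE j : (v 0 j)%:~R = D * u 0 j.
  by rewrite mxE /D [in RHS](bigD1 j) //= intrM numqE rmorph_prod -mulrA mulrC.
have D0 : D != 0.
  by apply/prodf_neq0 => i _; rewrite intr_eq0 denq_neq0.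
have v_orth p : \sum_j rel_row lam p 0 j * v 0 j = 0.
  apply/eqP; rewrite -(intr_eq0 rat) rmorph_sum /=.
  have := congr1 (fun B : 'rV_N => D * B 0 (enum_rank p)) uA.
  rewrite !mxE mulr0 mulr_sumr => e0; apply/eqP; rewrite -[RHS]e0.
  apply: eq_bigr => j _.
  by rewrite intrM vE !mxE enum_rankK mulrC mulrA.
have [j vj] : exists j, v 0 j != 0.
  have [j uj] := rV0Pn _ u0; exists j.
  by rewrite -(intr_eq0 rat) vE mulf_neq0.
exists v => t e /(congr1 (fun x : 'rV_m => \sum_j x 0 j * v 0 j)).
have -> : \sum_j comb lam e 0 j * v 0 j = 0.
  under eq_bigr => i _ do rewrite summxE mulr_suml.
  rewrite exchange_big big1 // => p _.
  under eq_bigr => i _ do rewrite mxE -mulrA.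
  by rewrite -mulr_sumr v_orth mulr0.
under eq_bigr => i _ do rewrite mxE -mulrA.
rewrite -mulr_sumr => /eqP; rewrite mulf_eq0 => /orP[/eqP//|].
rewrite psumr_eq0 => [/allP/(_ j)|i _]; last by rewrite -expr2 sqr_ge0.
by rewrite mem_index_enum -expr2 sqrf_eq0 (negPf vj) => /(_ isT).
Qed.

End Minors.

(** * Counting singular samples, and passing from rare failure to [aas] *)

Section Counting.

(** An element of [B] is determined by its values off [i0], so overwriting the value at [i0]
    arbitrarily embeds [B] times ['I_q] into all functions. *)
Lemma card_fibre (I : finType) q (i0 : I) (B : {set {ffun I -> 'I_q}}) :
  {in B &, forall f g : {ffun I -> 'I_q}, (forall i, i != i0 -> f i = g i) -> f = g} ->
  #|B| * q <= #|{ffun I -> 'I_q}|.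
Proof.
move=> fibB.
pose h (u : {ffun I -> 'I_q} * 'I_q) := [ffun i => if i == i0 then u.2 else u.1 i].
have -> : #|B| * q = #|setX B [set: 'I_q]| by rewrite cardsX cardsT card_ord.
rewrite -(@card_in_imset _ _ h); first exact: max_card.
move=> [f v] [g w]; rewrite !in_setX => /andP[fB _] /andP[gB _] /ffunP e.
congr pair; last by have := e i0; rewrite !ffunE eqxx.
by apply: fibB => // i /negPf ni; have := e i; rewrite !ffunE ni.
Qed.

Variables (n m l : nat).
Let samples : finType := {ffun Pairs n * 'I_m -> 'I_(2 * l + 1)}.

(* The determinant is affine in its top left variable, with slope the
   complementary minor: when the latter does not vanish, at most one value of
   that variable is bad. *)
Lemma card_singular_minor k (p : 'I_k -> Pairs n) (t : 'I_k -> 'I_m) :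
  injective p -> injective t ->
  #|[set L : samples | (\det (minor (decode L) p t) == 0)%R]| * (2 * l + 1)
    <= k * #|samples|.
Proof.
elim: k p t => [|k IH] p t injp injt.
  rewrite (_ : [set _ | _] = set0) ?cards0 //.
  by apply/setP => L; rewrite !inE det_mx00.
pose p' i := p (lift ord0 i); pose t' i := t (lift ord0 i).
pose small (L : samples) := (\det (minor (decode L) p' t') == 0)%R.
pose B := [set L : samples | (\det (minor (decode L) p t) == 0)%R & ~~ small L].
(* Singular samples with vanishing complementary minor contribute [k] by induction; the others form
   [B] and contribute 1 by [card_fibre]. *)
rewrite mulSn [X in _ <= X]addnC.
apply: (@leq_trans ((#|[set L | small L]| + #|B|) * (2 * l + 1))).
  rewrite leq_mul2r; apply/orP; right.
  apply: leq_trans (leq_card_setU _ _); apply/subset_leq_card/subsetP => L.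
  by rewrite !inE => ->; case: (small L).
rewrite mulnDl; apply: leq_add.
  by apply: IH => i j => [/injp | /injt] /lift_inj.
apply: (@card_fibre _ _ (p ord0, t ord0)) => f g.
rewrite !inE => /andP[/eqP f0 sf] /andP[/eqP g0 _] agree.
(* Injectivity of [p] and [t] ensures that the freed variable occurs only in the top left entry. *)
have decE i j : (i, j) != (ord0, ord0) ->
    decode f (p i) (t j) = decode g (p i) (t j).
  move=> ij; rewrite /decode agree //; apply: contraNneq ij => -[/injp-> /injt->].
  exact: eqxx.
have cofE j : cofactor (minor (decode f) p t) ord0 j
            = cofactor (minor (decode g) p t) ord0 j.
  by congr (_ * \det _)%R; apply/matrixP => x y; rewrite !mxE decE.
move: f0; rewrite -g0 !(expand_det_row _ ord0) !big_ord_recl /= cofE.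
under eq_bigr => j _ do rewrite mxE decE // cofE.
under [in RHS]eq_bigr => j _ do rewrite mxE.
move=> /addIr /eqP; rewrite -subr_eq0 -mulrBl mulf_eq0 -cofE => /orP[]; last first.
  rewrite /cofactor mulf_eq0 signr_eq0 /= => /eqP d0; case/negP: sf.
  rewrite /small -[X in _ == X]d0; apply/eqP; congr (\det _)%R.
  by apply/matrixP => x y; rewrite !mxE.
rewrite !mxE /decode subr_eq0 => /eqP/addIr[e]; apply/ffunP => -[q s].
have [->|] := eqVneq (q, s) (p ord0, t ord0); first exact: val_inj.
exact: agree.
Qed.

End Counting.

(** [P] quantifies over groups, so a boolean [bad] bounds its failure. The failure probability is at
    most K/(2l+1), below 1/k once l is at least kK. *)
Lemma aas_of_rare n m (P : (Pairs n -> 'I_m -> int) -> Prop)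
    (bad : (Pairs n -> 'I_m -> int) -> bool) (K : nat) :
  (forall lam, ~~ bad lam -> P lam) ->
  (forall l, #|[set L : {ffun Pairs n * 'I_m -> 'I_(2 * l + 1)} | bad (decode L)]|
             * (2 * l + 1) <= K * #|{ffun Pairs n * 'I_m -> 'I_(2 * l + 1)}|) ->
  aas P.
Proof.
move=> goodP rare k k0; exists (k * K) => l lel.
pose B := [set L : {ffun Pairs n * 'I_m -> 'I_(2 * l + 1)} | bad (decode L)].
exists (~: B); split=> [L|]; first by rewrite !inE => /goodP.
have {rare} := rare l; rewrite -/B -(cardsC B).
rewrite addnK; set b := #|B|; set T := b + _ => rare.
have q0 : 0 < 2 * l + 1 by rewrite addn1.
rewrite -(leq_pmul2r q0) -mulnA; apply: leq_trans (_ : k * (K * T) <= _).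
  by rewrite leq_mul2l rare orbT.
rewrite mulnA mulnC leq_mul2l; apply/orP; right.
by apply: (leq_trans lel); lia.
Qed.

(** Sorting the pairs by their larger index j gives j of them for each j. *)
Lemma card_Pairs n : #|{: Pairs n}| = (n * (n - 1)) %/ 2.
Proof.
rewrite card_sig -sum1_card.
rewrite -(pair_big_dep xpredT (fun i j : 'I_n => i < j) (fun _ _ => 1)) /=.
rewrite (exchange_big_dep xpredT) //=.
have -> : \sum_(j < n) \sum_(i < n | i < j) 1 = \sum_(j < n) (j : nat).
  apply: eq_bigr => j _; rewrite -(big_ord_widen n (fun=> 1)) ?(ltnW (ltn_ord j)) //.
  by rewrite sum1_card card_ord.
by rewrite -(big_mkord xpredT id) bin2_sum bin2 divn2 subn1.
Qed.

(** * Nondegeneracy of the commutator form from the rows of the pairs (0, j) *)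

Section Nondegenerate.
Local Open Scope ring_scope.
Variables (n m : nat) (lam : Pairs n.+2 -> 'I_m -> int).

Definition first_pair (j : 'I_n.+1) : Pairs n.+2 :=
  exist (fun p : 'I_n.+2 * 'I_n.+2 => p.1 < p.2)%N (ord0, lift ord0 j) isT.

Lemma first_pair_inj : injective first_pair.
Proof. by move=> i j [/addnI/val_inj]. Qed.

Lemma cocycle_0r x : cocycle lam x (delta_mx 0 ord0) = 0.
Proof.
apply: big1 => p _; rewrite mxE [(sval p).2 == _]negbTE ?mulr0 ?scale0r //.
by rewrite -val_eqE -lt0n (leq_trans _ (Pairs_lt p)).
Qed.

Lemma cocycleZr x a y : cocycle lam x (a *: y) = a *: cocycle lam x y.
Proof.
by rewrite scaler_sumr; apply: eq_bigr => p _; rewrite mxE mulrCA scalerA.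
Qed.

Lemma cocycleZl x a y : cocycle lam (a *: x) y = a *: cocycle lam x y.
Proof.
by rewrite scaler_sumr; apply: eq_bigr => p _; rewrite mxE -mulrA scalerA.
Qed.

Lemma cocycle_0l x : cocycle lam (delta_mx 0 ord0) x
  = \sum_j x 0 (lift ord0 j) *: rel_row lam (first_pair j).
Proof.
rewrite [x in LHS]row_sum_delta.
rewrite (big_morph _ (cocycleDr lam _) (cocycle0r lam _)) big_ord_recl.
rewrite cocycleZr cocycle_0r scaler0 add0r; apply: eq_bigr => j _.
by rewrite cocycleZr (cocycle_delta_lt lam (first_pair j)).
Qed.

(** Commuting with the generator of index 0 gives a relation among independent rows, which kills
    every coordinate of [x] but the one at 0. Then [x] is a multiple of that generator, and testing
    it against the next one kills the last coordinate. *)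
Lemma cocycle_nondegenerate (t : 'I_n.+1 -> 'I_m) :
  \det (minor lam first_pair t) != 0 ->
  forall x, (forall y, cocycle lam x y = cocycle lam y x) -> x = 0.
Proof.
move=> d0 x xc.
have x_lift j : x 0 (lift ord0 j) = 0.
  apply: (minor_independent (w := fun j => x 0 (lift ord0 j)) d0).
  by rewrite -cocycle_0l -xc cocycle_0r.
have x_delta : x = x 0 ord0 *: delta_mx 0 ord0.
  rewrite [LHS]row_sum_delta big_ord_recl big1 ?addr0 // => j _.
  by rewrite x_lift scale0r.
have x0 : x 0 ord0 = 0.
  pose w j := x 0 ord0 * (j == ord0 :> 'I_n.+1)%:R.
  suff /(minor_independent d0)/(_ ord0) : \sum_j w j *: rel_row lam (first_pair j) = 0.
    by rewrite /w eqxx mulr1.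
  rewrite big_ord_recl big1 => [|j _]; last by rewrite /w mulr0 scale0r.
  rewrite /w eqxx mulr1 addr0 -(cocycle_delta_lt lam (first_pair ord0)).
  by rewrite -cocycleZl -x_delta xc x_delta cocycleZr cocycle_0r scaler0.
by rewrite x_delta x0 scale0r.
Qed.

End Nondegenerate.

(** * Choice of the minors in the cases of few and of many central generators *)

Theorem theorem4p9 (n m : nat) (hn : 1 <= n - 1) (hm : n - 1 <= m) :
  ((m <= (n * (n - 1)) %/ 2) ->
     aas (fun lam => forall (G : group) (a : 'I_n -> G) (c : 'I_m -> G),
            presents lam a c ->
            finite_index (derived (G:=G)) (genC c) /\
            (n - 1 <= m -> regular G))) /\
  ((n * (n - 1)) %/ 2 < m ->
     aas (fun lam => forall (G : group) (a : 'I_n -> G) (c : 'I_m -> G),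
            presents lam a c ->
            [/\ free_abelian_basis (derived (G:=G))
                  (fun p : Pairs n => gcomm (a (sval p).1) (a (sval p).2)),
                ~ finite_index (derived (G:=G)) (genC c)
              & ~ regular G]) /\
     (forall (lam : Pairs n -> 'I_m -> int)
             (G : group) (a : 'I_n -> G) (c : 'I_m -> G),
        presents lam a c ->
        ~ finite_index (derived (G:=G)) (genC c) /\ ~ regular G)).
Proof.
rewrite -card_Pairs; case: n hn hm => [|[|n]] // _; rewrite subn1 /= => hm.
split=> [le_m|lt_m].
  (* The first m pairs with all m columns control the index; the n+1 pairs containing 0 with the
     first n+1 columns, available by [hm], control the center. *)
  pose p1 (i : 'I_m) : Pairs n.+2 := enum_val (widen_ord le_m i).
  pose bad1 (lam : Pairs n.+2 -> 'I_m -> int) := (\det (minor lam p1 id) == 0)%R.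
  pose bad2 (lam : Pairs n.+2 -> 'I_m -> int) :=
    (\det (minor lam (@first_pair n) (widen_ord hm)) == 0)%R.
  (* Union bound: the minors have sizes m and n+1, and the constants add. *)
  apply: (@aas_of_rare _ _ _ (fun lam => bad1 lam || bad2 lam) (m + n.+1)).
    move=> lam; rewrite negb_or => /andP[d1 d2] G a c /presents_iso[phi [psi iso]].
    have span := minor_span lam p1.
    split=> [|_]; first exact: (finite_index_full_rank iso d1 span).
    exact: (regular_full_rank iso d1 span (cocycle_nondegenerate d2)).
  move=> l.
  apply: (@leq_trans ((#|[set L : {ffun _ -> 'I_(2 * l + 1)} | bad1 (decode L)]|
     + #|[set L : {ffun _ -> 'I_(2 * l + 1)} | bad2 (decode L)]|) * (2 * l + 1))).
    rewrite leq_mul2r; apply/orP; right; apply: leq_trans (leq_card_setU _ _).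
    by apply/subset_leq_card/subsetP => L; rewrite !inE.
  rewrite !mulnDl; apply: leq_add; apply: card_singular_minor => //.
  - by move=> i j /enum_val_inj/(congr1 val)/= /val_inj.
  - exact: first_pair_inj.
  - by move=> i j /(congr1 val)/= /val_inj.
have never (lam : Pairs n.+2 -> 'I_m -> int)
    (G : group) (a : 'I_n.+2 -> G) (c : 'I_m -> G) : presents lam a c ->
    ~ finite_index (derived (G:=G)) (genC c) /\ ~ regular G.
  move=> /presents_iso[phi [psi iso]]; have [v v_free] := exists_free_vector lam lt_m.
  split; first exact: (infinite_index_of_free iso v_free).
  exact: (not_regular_of_free iso v_free).
(* For the basis, all rows are used with as many initial columns. *)
split=> //; pose t := widen_ord (ltnW lt_m).
apply: (@aas_of_rare _ _ _
  (fun lam => \det (minor lam enum_val t) == 0)%R #|{: Pairs n.+2}|).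
  move=> lam d0 G a c pres; have [inf nreg] := never _ _ _ _ pres; split=> //.
  have [phi [psi iso]] := presents_iso pres.
  apply: (free_basis_of_independent iso) => e; rewrite /comb => e0 p.
  rewrite -(enum_rankK p); apply: (minor_independent (w := fun i => e (enum_val i)) d0).
  by rewrite -[RHS]e0 [RHS](reindex _ (onW_bij _ (@enum_val_bij _))).
move=> l; apply: card_singular_minor; first exact: enum_val_inj.
by move=> i j /(congr1 val)/= /val_inj.
Qed.
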